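(* Let $x_1 \le \cdots \le x_n$ be fixed real numbers, let $p:\mathbb{R}\to[0,1]$, and let $Y_1,\dots,Y_n\in\{0,1\}$ be independent random variables with $\mathrm{pr}(Y_i=1)=p(x_i)$ for $i=1,\dots,n$. Let $\alpha\in(0,1)$, let $N$ be the number of distinct elements of $\{x_1,\dots,x_n\}$, and for $x\in\mathbb{R}$ let \[ U^{\alpha,\mathrm{raw}}(x)=\inf_{(j,k)\in\mathcal{J}:\,x_j\ge x} u^{\alpha/(N^2+N)}(Z_{jk},n_{jk}),\qquad L^{\alpha,\mathrm{raw}}(x)=\sup_{(j,k)\in\mathcal{J}:\,x_k\le x} \ell^{\alpha/(N^2+N)}(Z_{jk},n_{jk}), \] where the infimum over the empty set is $1$ and the supremum over the empty set is $0$. If $p$ is isotonic, i.e. $p(x)\le p(x')$ whenever $x\le x'$, then \[ \mathrm{pr}\{L^{\alpha,\mathrm{raw}}(x)\le p(x)\le U^{\alpha,\mathrm{raw}}(x)\ \text{for all } x\in\mathbb{R}\}\ge 1-\alpha . \]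
   Context: Set $x_0:=-\infty$, $x_{n+1}:=\infty$. $\mathcal{J}$ is the set of all index pairs $(j,k)$ with $1\le j\le k\le n$, $x_{j-1}<x_j$ and $x_k<x_{k+1}$. For $1\le j\le k\le n$, $n_{jk}=k-j+1$ and $Z_{jk}=\sum_{i=j}^k Y_i$. Clopper–Pearson bounds: for an integer $m\ge1$, $z\in\{0,\dots,m\}$ and $\delta\in(0,1)$, $u^\delta(z,m)=\max\{\xi\in[0,1]:\mathrm{pbin}(z,m,\xi)\ge\delta\}$ and $\ell^\delta(z,m)=\min\{\xi\in[0,1]:\mathrm{pbin}(z-1,m,\xi)\le 1-\delta\}$, where $\mathrm{pbin}(\cdot,m,\xi)$ is the distribution function of the binomial distribution with parameters $m$ and $\xi$. *)

(* Defs.v *)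
From HB Require Import structures.
From mathcomp Require Import all_boot all_order all_algebra.
From mathcomp Require Import all_classical all_reals all_analysis.

Set Implicit Arguments.
Unset Strict Implicit.
Unset Printing Implicit Defensive.

Import Order.TTheory GRing.Theory Num.Theory.
Import numFieldNormedType.Exports.

Local Open Scope classical_set_scope.
Local Open Scope ring_scope.

Definition mutual_independence d d' (T : measurableType d)
    (T' : measurableType d') (R : realType) (P : probability T R) (I : finType)
    (X : I -> {RV P >-> T'}) : Prop :=
  forall (A : {set I}) (B : I -> set T'), (forall i, measurable (B i)) ->
    P (\bigcap_(i in [set` A]) (X i @^-1` B i)) =
    (\prod_(i in A) P (X i @^-1` B i))%E.

(* The argument z is an integer because the Clopper-Pearson lower bound uses
   z - 1, which is -1 when no success is observed. *)
Definition pbin (R : realType) (z : int) (m : nat) (xi : R) : R :=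
  fine (binomial_prob m xi [set k : nat | k%:Z <= z]).

(* Greatest and least element of A; junk values when A has none. *)
Definition set_max (R : realType) (A : set R) : R := get (A `&` ubound A).
Definition set_min (R : realType) (A : set R) : R := get (A `&` lbound A).

Definition cp_upper (R : realType) (delta : R) (z m : nat) : R :=
  set_max [set xi : R | 0 <= xi <= 1 /\ delta <= pbin z%:Z m xi].

Definition cp_lower (R : realType) (delta : R) (z m : nat) : R :=
  set_min [set xi : R | 0 <= xi <= 1 /\ pbin (z%:Z - 1) m xi <= 1 - delta].

(* The sample points are stored from index 0 in x : 'I_n -> R.  The function
   design x i is x_i in the usual numbering from 1, extended by x_0 = -oo and
   x_(n+1) = +oo. *)
Definition design (R : realType) (n : nat) (x : 'I_n -> R) (i : nat) : \bar R :=
  if i is i'.+1 then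
    if insub i' is Some k then (x k)%:E else +oo%E
  else -oo%E.

(* The indices j, k : 'I_n stand for j + 1, k + 1 in the numbering from 1. *)
Definition index_pairs (R : realType) (n : nat) (x : 'I_n -> R) :
    set ('I_n * 'I_n) :=
  [set jk : 'I_n * 'I_n |
    [/\ (jk.1 <= jk.2)%N,
        (design x jk.1 < design x jk.1.+1)%E &
        (design x jk.2.+1 < design x jk.2.+2)%E]].

Definition block_size (n : nat) (j k : 'I_n) : nat := (k - j + 1)%N.

Definition block_sum (n : nat) (y : 'I_n -> bool) (j k : 'I_n) : nat :=
  (\sum_(i < n | j <= i <= k) y i)%N.

Definition num_distinct (R : realType) (n : nat) (x : 'I_n -> R) : nat :=
  size (undup [seq x i | i <- enum 'I_n]).

Definition inf_or1 (R : realType) (A : set R) : R :=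
  if A == set0 then 1 else inf A.

Definition sup_or0 (R : realType) (A : set R) : R :=
  if A == set0 then 0 else sup A.

Definition raw_level (R : realType) (n : nat) (x : 'I_n -> R) (alpha : R) : R :=
  alpha / (num_distinct x ^ 2 + num_distinct x)%:R.

Definition U_raw (R : realType) (n : nat) (x : 'I_n -> R) (alpha : R)
    (y : 'I_n -> bool) (t : R) : R :=
  inf_or1 [set cp_upper (raw_level x alpha) (block_sum y jk.1 jk.2)
                        (block_size jk.1 jk.2)
          | jk in [set jk | index_pairs x jk /\ t <= x jk.1]].

Definition L_raw (R : realType) (n : nat) (x : 'I_n -> R) (alpha : R)
    (y : 'I_n -> bool) (t : R) : R :=
  sup_or0 [set cp_lower (raw_level x alpha) (block_sum y jk.1 jk.2)
                        (block_size jk.1 jk.2)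
          | jk in [set jk | index_pairs x jk /\ x jk.2 <= t]].

(* Main.v *)
Require Import Defs.
From mathcomp Require Import all_boot all_order all_algebra.
From mathcomp Require Import all_classical all_reals all_analysis.
From mathcomp Require Import ring lra.

Import Order.TTheory GRing.Theory Num.Theory.
Import numFieldNormedType.Exports.
Local Open Scope classical_set_scope.
Local Open Scope ring_scope.

(* For an index pair (j, k), isotonicity gives p (x_j) <= p (x_i) <= p (x_k) for
   j <= i <= k, so Z_jk is stochastically larger than Bin(n_jk, p (x_j)) and
   smaller than Bin(n_jk, p (x_k)).  Hence each of p (x_j) <= u(Z_jk, n_jk) and
   l(Z_jk, n_jk) <= p (x_k) fails with probability at most
   delta = alpha / (N^2 + N).  An index pair is determined by the values
   x_j <= x_k, so there are at most (N^2 + N) / 2 of them, and by the union bound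
   all these inequalities hold simultaneously with probability at least
   1 - alpha.  By isotonicity again, they imply L(t) <= p t <= U(t) for all t. *)

(* Probability that a sum of independent Bernoulli variables with success
   probabilities s is < z.  The strict inequality keeps z - 1 = -1 out of the
   Clopper-Pearson lower bound; at z = 0 both terms below vanish although
   0.-1 = 0. *)

Fixpoint pb_cdf {R : realType} (s : seq R) (z : nat) : R :=
  if s is q :: s' then q * pb_cdf s' z.-1 + (1 - q) * pb_cdf s' z
  else (0 < z)%:R.

(** * Poisson-binomial distribution functions and their comparison with binomial ones *)

Section PoissonBinomial.
Variable R : realType.
Implicit Types (s : seq R) (q : R) (z m : nat).

Lemma pb_cdf_size s z : (size s < z)%N -> pb_cdf s z = 1.
Proof.
elim: s z => [|q s IHs] z /=; first by move->.
by move=> sz; rewrite !IHs ?ltn_predRL ?(ltnW sz)//; lra.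
Qed.

Lemma pb_cdf_pred s z : all (fun q => 0 <= q <= 1) s ->
  pb_cdf s z.-1 <= pb_cdf s z.
Proof.
elim: s z => [|q s IHs] [|[|z]] //=; rewrite ?ler01//.
  (* At [z = 1] the [q]-terms of both sides are taken at 0, since [0.-1 = 0]; only the other terms
     need comparing. *)
  move=> /andP[/andP[q0 q1] /IHs h].
  apply: lerD => //; apply: ler_wpM2l; rewrite ?subr_ge0//; exact: (h 1).
move=> /andP[/andP[q0 q1] /IHs h].
apply: lerD; apply: ler_wpM2l; rewrite ?subr_ge0//.
  exact: (h z.+1).
exact: (h z.+2).
Qed.

(** Stochastic comparison, one coordinate at a time: lowering the head from [r] to [q] moves weight
    [r - q] from the value at [z.-1] to the value at [z], which is no smaller by [pb_cdf_pred]. *)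
Lemma pb_cdf_nseq_ge s q z : all (fun r => 0 <= r <= 1) s -> 0 <= q <= 1 ->
  {in s, forall r, q <= r} -> pb_cdf s z <= pb_cdf (nseq (size s) q) z.
Proof.
move=> + q01; elim: s z => //= r s IHs z /andP[/andP[r0 r1] s01] qs.
have [q0 q1] := andP q01.
have qr : q <= r by apply: qs; rewrite mem_head.
have {}IHs z' : pb_cdf s z' <= pb_cdf (nseq (size s) q) z'.
  by apply: IHs => // t ts; apply: qs; rewrite inE ts orbT.
have mono := pb_cdf_pred (nseq (size s) q) z.
rewrite all_nseq q01 orbT in mono; have {}mono := mono isT.
have := IHs z.-1; have := IHs z; nra.
Qed.

Lemma pb_cdf_nseq_le s q z : all (fun r => 0 <= r <= 1) s -> 0 <= q <= 1 ->
  {in s, forall r, r <= q} -> pb_cdf (nseq (size s) q) z <= pb_cdf s z.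
Proof.
move=> + q01; elim: s z => //= r s IHs z /andP[/andP[r0 r1] s01] qs.
have [q0 q1] := andP q01.
have qr : r <= q by apply: qs; rewrite mem_head.
have {}IHs z' : pb_cdf (nseq (size s) q) z' <= pb_cdf s z'.
  by apply: IHs => // t ts; apply: qs; rewrite inE ts orbT.
have mono := pb_cdf_pred (nseq (size s) q) z.
rewrite all_nseq q01 orbT in mono; have {}mono := mono isT.
have := IHs z.-1; have := IHs z; nra.
Qed.

Lemma pb_cdf_nseq0 m z : pb_cdf (nseq m (0 : R)) z.+1 = 1.
Proof. by elim: m z => //= m IHm z; rewrite IHm mul0r add0r subr0 mul1r. Qed.

Lemma pb_cdf_nseq1 m z : (z <= m)%N ->
  pb_cdf (nseq m (1 : R)) z = 0.
Proof.
elim: m z => [[]//|m IHm z zm] /=; rewrite subrr mul0r addr0 mul1r IHm//.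
by case: z zm.
Qed.

Lemma continuous_pb_cdf m z : continuous (fun q => pb_cdf (nseq m q) z).
Proof.
elim: m z => [|m IHm] z q /=; first exact: cvg_cst.
apply: cvgD; apply: cvgM; [exact: cvg_id | exact: IHm | | exact: IHm].
by apply: cvgB; [exact: cvg_cst | exact: cvg_id].
Qed.

(** Pascal's rule, in the form of conditioning on one trial, which is the recursion defining
    [pb_cdf]. *)
Lemma binomial_pmfS m q k : binomial_pmf m.+1 q k.+1 =
  q * binomial_pmf m q k + (1 - q) * binomial_pmf m q k.+1.
Proof.
rewrite /binomial_pmf binS mulrnDr subSS addrC; congr (_ + _).
  by rewrite exprS -mulrA mulrnAr.
have [km|mk] := ltnP k m; last by rewrite bin_small// !mulr0n mulr0.
by rewrite mulrnAr; congr (_ *+ _); rewrite mulrCA -exprS subnSK.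
Qed.

Lemma pb_cdf_nseqE m q z :
  pb_cdf (nseq m q) z = \sum_(k < z) binomial_pmf m q k.
Proof.
elim: m z => [|m IHm] z /=.
  case: z => [|z]; first by rewrite big_ord0.
  rewrite big_ord_recl big1 ?addr0 => [|i _].
    by rewrite /binomial_pmf bin0 !expr0 mulr1.
  by rewrite /binomial_pmf bin_small.
rewrite !IHm; case: z => [|z]; first by rewrite !big_ord0 !mulr0 addr0.
rewrite /= big_ord_recl [RHS]big_ord_recl /=.
under [X in _ = _ + X]eq_bigr do rewrite binomial_pmfS.
rewrite big_split /= -!mulr_sumr mulrDr addrCA; congr (_ + _).
by rewrite /binomial_pmf !bin0 !expr0 !subn0 !mulr1n !mul1r -exprS.
Qed.

(** Describing the threshold by a natural number [n] treats the cutoffs [z] and [z - 1] alike; the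
    cutoff -1 corresponds to [n = 0]. *)
Lemma pbinE (z : int) m q n : 0 <= q <= 1 ->
  (forall k : nat, (k%:Z <= z) = (k < n)%N) ->
  pbin z m q = pb_cdf (nseq m q) n.
Proof.
move=> q01 zn; rewrite /pbin /binomial_prob q01.
have -> : [set k : nat | k%:Z <= z] = `I_n.
  by apply/seteqP; split => k /=; rewrite zn.
rewrite esum_fset//=; last by move=> i _; rewrite lee_fin binomial_pmf_ge0.
by rewrite -fsbig_ord sumEFin /= pb_cdf_nseqE.
Qed.

Lemma pbin_nat z m q : 0 <= q <= 1 ->
  pbin z%:Z m q = pb_cdf (nseq m q) z.+1.
Proof. by move=> q01; apply: pbinE => // k; rewrite lez_nat ltnS. Qed.

Lemma pbin_pred z m q : 0 <= q <= 1 ->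
  pbin (z%:Z - 1) m q = pb_cdf (nseq m q) z.
Proof. by move=> q01; apply: pbinE => // k; rewrite lerBrDr addrC lez_nat. Qed.

End PoissonBinomial.

(** * Clopper-Pearson bounds as extrema of compact sets *)

(** By compactness the identity attains its maximum on [A], so [get] does not return a junk
    value. *)
Lemma ubound_set_max (R : realType) (A : set R) : A !=set0 -> compact A ->
  ubound A (set_max A).
Proof.
move=> A0 cA; have [|c] := @compact_EVT_max _ _ id A A0 cA.
  by apply: continuous_subspaceT => x.
rewrite inE => Ac cmax; suff [] : (A `&` ubound A) (set_max A) by [].
by apply: (@getI _ _ c); split=> // t At; apply: cmax; rewrite inE.
Qed.

Lemma lbound_set_min (R : realType) (A : set R) : A !=set0 -> compact A ->
  lbound A (set_min A).
Proof.
move=> A0 cA; have [|c] := @compact_EVT_min _ _ id A A0 cA.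
  by apply: continuous_subspaceT => x.
rewrite inE => Ac cmin; suff [] : (A `&` lbound A) (set_min A) by [].
by apply: (@getI _ _ c); split=> // t At; apply: cmin; rewrite inE.
Qed.

Lemma compact_unit_preimage (R : realType) (f : R -> R) (D : set R) :
  continuous f -> closed D ->
  compact [set xi : R | 0 <= xi <= 1 /\ D (f xi)].
Proof.
move=> cf cD; have -> : [set xi : R | 0 <= xi <= 1 /\ D (f xi)] =
    `[0, 1] `&` f @^-1` D.
  by apply/seteqP; split => r /=; rewrite in_itv.
have cl : closed (f @^-1` D) by apply: preimage_closed => // r _; exact: cf.
exact: compact_closedI (@segment_compact R 0 1) cl.
Qed.

(** Contrapositive: if [q] satisfies the defining inequality, it lies below the maximum of the
    defining set. *)
Lemma cp_upper_lt (R : realType) (delta q : R) z m : delta <= 1 ->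
  0 <= q <= 1 -> cp_upper delta z m < q -> pb_cdf (nseq m q) z.+1 < delta.
Proof.
move=> d1 q01; rewrite !ltNge; apply: contra => dq; rewrite /cp_upper.
have -> : [set xi : R | 0 <= xi <= 1 /\ delta <= pbin z%:Z m xi] =
    [set xi : R | 0 <= xi <= 1 /\
      [set r | delta <= r] (pb_cdf (nseq m xi) z.+1)].
  by apply/seteqP; split => r /= [r01]; rewrite pbin_nat.
set A := [set xi | _]; suff /(_ q (conj q01 dq)) : ubound A (set_max A) by [].
apply: ubound_set_max.
  (* With success probability 0 the distribution function at any count is 1, hence at least
     [delta]. *)
  by exists 0; rewrite /A /= lexx ler01 pb_cdf_nseq0.
by apply: compact_unit_preimage; [exact: continuous_pb_cdf | exact: closed_ge].
Qed.

Lemma cp_lower_gt (R : realType) (delta q : R) z m : delta <= 1 ->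
  (z <= m)%N -> 0 <= q <= 1 -> q < cp_lower delta z m ->
  1 - delta < pb_cdf (nseq m q) z.
Proof.
move=> d1 zm q01; rewrite !ltNge; apply: contra => dq; rewrite /cp_lower.
have -> : [set xi : R | 0 <= xi <= 1 /\ pbin (z%:Z - 1) m xi <= 1 - delta] =
    [set xi : R | 0 <= xi <= 1 /\
      [set r | r <= 1 - delta] (pb_cdf (nseq m xi) z)].
  by apply/seteqP; split => r /= [r01]; rewrite pbin_pred.
set A := [set xi | _]; suff /(_ q (conj q01 dq)) : lbound A (set_min A) by [].
apply: lbound_set_min.
  (* With success probability 1 the sum is [m], which is never below [z <= m]. *)
  by exists 1; rewrite /A /= lexx ler01 pb_cdf_nseq1// subr_ge0.
by apply: compact_unit_preimage; [exact: continuous_pb_cdf | exact: closed_le].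
Qed.


(** * Law of sums of independent Bernoulli variables and miscoverage of a single bound *)

Section BernoulliFamily.
Variables (R : realType) (d : measure_display) (T : measurableType d).
Variables (P : probability T R) (I : finType) (Y : I -> {RV P >-> bool}).

(** The family takes finitely many values, so the event is a finite union of cylinders. As [Q] is
    arbitrary, this also covers events quantified over all real [t]. *)
Lemma measurable_RV_finite (Q : (I -> bool) -> Prop) :
  measurable [set w | Q (fun i => Y i w)].
Proof.
have -> : [set w | Q (fun i => Y i w)] =
    \bigcup_(b in [set b : {ffun I -> bool} | Q b])
      \bigcap_(i in [set: I]) (Y i @^-1` [set b i]).
  apply/seteqP; split => w /= => [Qw|[b Qb Yb]].
    exists [ffun i => Y i w] => [|i _] /=; last by rewrite ffunE.
    by congr Q: Qw; apply/funext => i; rewrite ffunE.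
  by congr Q: Qb; apply/funext => i; rewrite Yb.
apply: fin_bigcup_measurable => [|b _]; first exact: finite_finset.
apply: fin_bigcap_measurable => [|i _]; first exact: finite_finset.
by rewrite -[X in measurable X]setTI; apply: measurable_funP.
Qed.

Hypothesis Y_indep : mutual_independence Y.
Variable q : I -> R.
Hypothesis Y_dist : forall i, P (Y i @^-1` [set true]) = (q i)%:E.

Lemma prob_RV_bool i b :
  P (Y i @^-1` [set b]) = (if b then q i else 1 - q i)%:E.
Proof.
case: b => //; have -> : Y i @^-1` [set false] = ~` (Y i @^-1` [set true]).
  by apply/seteqP; split => w /=; case: (Y i w).
rewrite probability_setC ?Y_dist//.
exact: (measurable_RV_finite (fun b => b i = true)).
Qed.

(* The event on A makes the induction on s go through: splitting on the value of
   Y at the head of s only enlarges A. *)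
Lemma prob_sum_lt_joint (s : seq I) (A : {set I}) (c : I -> bool) z :
  uniq s -> (forall i, i \in s -> i \notin A) ->
  P [set w | (forall i, i \in A -> Y i w = c i) /\
             (\sum_(i <- s) Y i w < z)%N] =
  ((\prod_(i in A) (if c i then q i else 1 - q i)) *
    pb_cdf [seq q i | i <- s] z)%:E.
Proof.
elim: s A c z => [|i s IHs] A c z.
  move=> _ _ /=; case: z => [|z].
    rewrite mulr0 (_ : [set w | _] = set0) ?measure0//.
    by apply/seteqP; split=> w //= [].
  rewrite mulr1 (_ : [set w | _] =
      \bigcap_(i in [set` A]) (Y i @^-1` [set c i])); last first.
    by apply/seteqP; split=> w /= => [[] //|h]; split; rewrite ?big_nil.
  rewrite (Y_indep _ (fun i => [set c i]))//.
  by rewrite -prodEFin; apply: eq_bigr => i _; exact: prob_RV_bool.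
move=> /= /andP[i_s us] sA.
have iA : i \notin A by apply: sA; rewrite mem_head.
pose c' b := fun j => if j == i then b else c j.
have sA' j : j \in s -> j \notin i |: A.
  move=> js; rewrite in_setU1 negb_or sA ?inE ?js ?orbT// andbT.
  by apply: contraNneq i_s => <-.
(* [E b] adds the constraint [Y i = b]; a success at [i] leaves the other summands one unit less. *)
pose E b := [set w | (forall j, j \in i |: A -> Y j w = c' b j) /\
             (\sum_(j <- s) Y j w < if b then z.-1 else z)%N].
have PE b : P (E b) = ((if b then q i else 1 - q i) *
    (\prod_(j in A) (if c j then q j else 1 - q j)) *
      pb_cdf [seq q j | j <- s] (if b then z.-1 else z))%:E.
  rewrite IHs// big_setU1//= {1}/c' eqxx; congr (_ * _ * _)%:E.
  apply: eq_bigr => j jA; rewrite /c'; case: eqP => // ji.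
  by rewrite -ji jA in iA.
have mE b : measurable (E b).
  exact: (measurable_RV_finite (fun y => (forall j, j \in i |: A -> y j = c' b j)
    /\ (\sum_(j <- s) y j < if b then z.-1 else z)%N)).
rewrite (_ : [set w | _] = E true `|` E false); last first.
  apply/seteqP; split => w /=; rewrite big_cons.
    case=> YA Yz; case Yi : (Y i w) Yz => Yz; [left|right]; split.
    - move=> j; rewrite in_setU1 /c'; case: eqP => [->//|_] /=; exact: YA.
    (* [1 + S < z] is equivalent to [S < z.-1] even at [z = 0], where both fail. *)
    - by rewrite ltn_predRL.
    - move=> j; rewrite in_setU1 /c'; case: eqP => [->//|_] /=; exact: YA.
    - by [].
  by case=> -[YA Yz]; (split;
    [move=> j jA; rewrite YA ?in_setU1 ?jA ?orbT// /c';
      case: eqP => // ji; rewrite -ji jA in iA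
    |rewrite YA ?setU11// /c' eqxx// -ltn_predRL]).
transitivity (P (E true) + P (E false))%E.
  apply: measureU => //; apply/seteqP; split => w //= -[[Yt _] [Yf _]].
  by have := Yt i; rewrite Yf ?setU11// /c' eqxx => /(_ isT).
by rewrite !PE -EFinD; congr _%:E; ring.
Qed.

Lemma prob_sum_lt (s : seq I) z : uniq s ->
  P [set w | (\sum_(i <- s) Y i w < z)%N] = (pb_cdf [seq q i | i <- s] z)%:E.
Proof.
move=> us; have := prob_sum_lt_joint s finset.set0 (fun _ => true) z us.
rewrite big_set0 mul1r => <-; last by move=> i _; rewrite inE.
congr (P _); apply/seteqP; split => w /=; last by case.
by move=> wz; split => // i; rewrite inE.
Qed.

Hypothesis q01 : forall i, 0 <= q i <= 1.

(** Miscoverage forces the observed sum to be a [bad] count, hence at most the largest such [z]. By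
    stochastic comparison, the probability of a sum at most [z] is bounded by its binomial
    counterpart with parameter [r], which is below [delta] because [z] is bad. *)
Lemma miscoverage_upper (delta r : R) (s : seq I) : uniq s ->
  0 <= delta <= 1 -> 0 <= r <= 1 -> {in s, forall i, r <= q i} ->
  (P [set w | (cp_upper delta (\sum_(i <- s) Y i w) (size s) < r)%R]
    <= delta%:E)%E.
Proof.
move=> us /andP[d0 d1] r01 rq.
have mZ z : measurable [set w | (\sum_(i <- s) Y i w < z)%N].
  exact: (measurable_RV_finite (fun y => (\sum_(i <- s) y i < z)%N)).
pose bad z := pb_cdf (nseq (size s) r) z.+1 < delta.
(* Above the number of trials the distribution function is [1 >= delta], so a largest bad count
   exists once there is one. *)
have bad_le z : bad z -> (z <= size s)%N.
  rewrite /bad leqNgt; apply: contraL => sz.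
  by rewrite pb_cdf_size ?size_nseq ?(leq_trans sz)// -leNgt.
have [[z0 bz0]|nobad] := pselect (exists z, bad z); last first.
  rewrite (_ : [set w | _] = set0) ?measure0//.
  apply/seteqP; split => w //= /(cp_upper_lt _ _ _ _ _ d1 r01) bw.
  by apply: nobad; exists (\sum_(i <- s) Y i w)%N.
have [z bz zmax] := ex_maxnP (ex_intro _ z0 bz0) bad_le.
apply: (@le_trans _ _ (P [set w | (\sum_(i <- s) Y i w < z.+1)%N])).
  apply: le_measure; rewrite ?inE//.
    exact: (measurable_RV_finite
      (fun y => cp_upper delta (\sum_(i <- s) y i) (size s) < r)).
  by move=> w /= /(cp_upper_lt _ _ _ _ _ d1 r01) /zmax; rewrite ltnS.
rewrite prob_sum_lt// lee_fin (le_trans _ (ltW bz))//.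
rewrite -(size_map q); apply: pb_cdf_nseq_ge => //.
  by apply/allP => _ /mapP[i _ ->].
by move=> _ /mapP[i si ->]; exact: rq.
Qed.

(** Dual argument with the smallest bad count [z]: miscoverage forces the sum to be at least [z], an
    event whose probability is at most its binomial counterpart, which is below [delta]. *)
Lemma miscoverage_lower (delta r : R) (s : seq I) : uniq s ->
  0 <= delta <= 1 -> 0 <= r <= 1 -> {in s, forall i, q i <= r} ->
  (P [set w | (r < cp_lower delta (\sum_(i <- s) Y i w) (size s))%R]
    <= delta%:E)%E.
Proof.
move=> us /andP[d0 d1] r01 rq.
have Zs w : (\sum_(i <- s) Y i w <= size s)%N.
  by rewrite -sum1_size leq_sum// => i _; case: (Y i w).
have mZ z : measurable [set w | (\sum_(i <- s) Y i w < z)%N].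
  exact: (measurable_RV_finite (fun y => (\sum_(i <- s) y i < z)%N)).
pose bad z := 1 - delta < pb_cdf (nseq (size s) r) z.
have [[z0 bz0]|nobad] := pselect (exists z, bad z); last first.
  rewrite (_ : [set w | _] = set0) ?measure0//.
  apply/seteqP; split => w //= /(cp_lower_gt _ _ _ _ _ d1 (Zs w) r01) bw.
  by apply: nobad; exists (\sum_(i <- s) Y i w)%N.
have [z bz zmin] := ex_minnP (ex_intro _ z0 bz0).
apply: (@le_trans _ _ (P (~` [set w | (\sum_(i <- s) Y i w < z)%N]))).
  apply: le_measure; rewrite ?inE//; last 1 first.
  - move=> w /= /(cp_lower_gt _ _ _ _ _ d1 (Zs w) r01) /zmin.
    by rewrite leqNgt => /negP.
  - exact: (measurable_RV_finite
      (fun y => r < cp_lower delta (\sum_(i <- s) y i) (size s))).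
  - exact: measurableC.
rewrite probability_setC// prob_sum_lt// -EFinB lee_fin lerBlDr -lerBlDl.
rewrite (le_trans (ltW bz))//.
rewrite -(size_map q); apply: pb_cdf_nseq_le => //.
  by apply/allP => _ /mapP[i _ ->].
by move=> _ /mapP[i si ->]; exact: rq.
Qed.

End BernoulliFamily.


(** * Finite subadditivity and blocks of consecutive indices *)

Lemma le_measure_bigsetU (R : realType) (d : measure_display)
    (T : measurableType d) (P : {measure set T -> \bar R}) (I : Type)
    (s : seq I) (Q : pred I) (F : I -> set T) :
  (forall i, measurable (F i)) ->
  (P (\big[setU/set0]_(i <- s | Q i) F i) <= \sum_(i <- s | Q i) P (F i))%E.
Proof.
move=> mF; elim: s => [|i s IHs]; first by rewrite !big_nil measure0.
rewrite !big_cons; case: ifP => // _.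
apply: le_trans (leeD2l _ IHs); apply: measureU2 => //.
exact: bigsetU_measurable.
Qed.

Section Blocks.
Context {n : nat}.

Definition block (j k : 'I_n) : seq 'I_n :=
  [seq i : 'I_n <- index_enum 'I_n | (j <= i <= k)%N].

Lemma block_uniq j k : uniq (block j k).
Proof. exact/filter_uniq/index_enum_uniq. Qed.

Lemma block_sumE y j k : block_sum y j k = (\sum_(i <- block j k) y i)%N.
Proof. by rewrite big_filter. Qed.

Lemma block_sizeE (j k : 'I_n) : (j <= k)%N ->
  block_size j k = size (block j k).
Proof.
move=> jk; rewrite size_filter -sum1_count /block_size addn1 -subSn//.
under eq_bigl do rewrite andbC -[(_ <= k)%N]ltnS.
rewrite -(big_geq_mkord j n (fun i => (i < k.+1)%N) (fun=> 1%N)).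
by rewrite -(big_nat_widen _ _ _ xpredT)// sum_nat_const_nat muln1.
Qed.

End Blocks.

(** * Counting index pairs *)

(** Inclusion-exclusion: the ordered pairs and their transposes cover the square and meet in the
    diagonal. *)
Lemma card_le_pairs (R : realType) (s : seq R) : uniq s ->
  (#|[set ab : seq_sub s * seq_sub s | (ssval ab.1 <= ssval ab.2)%R]%SET| * 2 =
    size s ^ 2 + size s)%N.
Proof.
move=> us; set S := [set _ | _]%SET.
pose S' := [set ab : seq_sub s * seq_sub s | ssval ab.2 <= ssval ab.1]%SET.
have SS' : #|S'| = #|S|.
  rewrite -(@card_imset _ _ (fun ab => (ab.2, ab.1)) S); last first.
    by move=> [a b] [c d] [-> ->].
  apply: eq_card => -[a b]; rewrite !inE /=.
  apply/idP/imsetP => [ba|[[a' b'] + [-> ->]]]; last by rewrite inE.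
  by exists (b, a); rewrite ?inE.
have SUS' : #|(S :|: S')%SET| = (size s ^ 2)%N.
  rewrite (_ : (S :|: S')%SET = [set: _]%SET) ?cardsT ?card_prod ?card_seq_sub//.
  by apply/setP => -[a b]; rewrite !inE /= le_total.
have SIS' : #|(S :&: S')%SET| = size s.
  rewrite -[RHS](card_seq_sub us) -cardsT.
  rewrite -(@card_imset _ _ (fun a : seq_sub s => (a, a)) [set: seq_sub s]%SET).
    apply: eq_card => -[a b]; rewrite !inE /= -eq_le.
    apply/eqP/imsetP => [/val_inj->|[c _ [-> ->]]//].
    by exists b; rewrite ?inE.
  by move=> a b [].
by rewrite -SUS' -[X in (_ + X)%N]SIS' cardsUI SS' muln2 addnn.
Qed.

Section Counting.
Variables (R : realType) (n : nat) (x : 'I_n -> R).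
Hypothesis x_sorted : forall i j : 'I_n, (i <= j)%N -> x i <= x j.

Lemma design_ord (i : 'I_n) : design x i.+1 = (x i)%:E.
Proof. by rewrite /design valK. Qed.

(** If [i < j], the point just before [x j] is at least [x i = x j] by sortedness, against the
    strict increase into [j]. *)
Lemma left_end_inj (i j : 'I_n) : (design x i < design x i.+1)%E ->
  (design x j < design x j.+1)%E -> x i = x j -> i = j.
Proof.
wlog ij : i j / (i < j)%N.
  move=> H di dj xij; apply/val_inj; case: (ltngtP i j) => // ij.
    by rewrite (H i j).
  by rewrite (H j i).
move=> _ + xij; case: j ij xij => [[//|m] mn] im xij.
rewrite (design_ord (Ordinal (ltnW mn))) (design_ord (Ordinal mn)).
by rewrite lte_fin -xij ltNge x_sorted.
Qed.

(** If [i < j], the point just after [x i] is at most [x j = x i], against the strict increase out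
    of [i]. *)
Lemma right_end_inj (i j : 'I_n) : (design x i.+1 < design x i.+2)%E ->
  (design x j.+1 < design x j.+2)%E -> x i = x j -> i = j.
Proof.
wlog ij : i j / (i < j)%N.
  move=> H di dj xij; apply/val_inj; case: (ltngtP i j) => // ij.
    by rewrite (H i j).
  by rewrite (H j i).
move=> + _ xij; have i1n : (i.+1 < n)%N by apply: leq_ltn_trans ij _.
rewrite (design_ord i) (design_ord (Ordinal i1n)).
by rewrite lte_fin xij ltNge x_sorted.
Qed.

(** Sending [(j, k)] to the values [(x j, x k)] is injective on index pairs and lands in the ordered
    pairs of distinct design values. *)
Lemma card_index_pairs :
  (#|[set jk | `[< index_pairs x jk >]]%SET| * 2 <=
    num_distinct x ^ 2 + num_distinct x)%N.
Proof.
set J := [set _ | _]%SET; rewrite /num_distinct; set s := undup _.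
rewrite -(card_le_pairs _ s (undup_uniq _)) leq_pmul2r//.
have xs i : x i \in s by rewrite mem_undup map_f// mem_enum.
pose f (jk : 'I_n * 'I_n) := (SeqSub (xs jk.1), SeqSub (xs jk.2)).
rewrite -(card_in_imset (f := f)) => [|[i j] [k l]]; last first.
  rewrite !inE => -[/= _ di dj] [/= _ dk dl] [xik xjl].
  by rewrite (left_end_inj _ _ di dk xik) (right_end_inj _ _ dj dl xjl).
apply/subset_leq_card/fintype.subsetP => _ /imsetP[jk + ->].
by rewrite !inE => -[jk12 _ _] /=; exact: x_sorted.
Qed.

End Counting.

(** * Simultaneous coverage by the union bound *)

Theorem theorem1 (R : realType) (d : measure_display) (T : measurableType d)
    (P : probability T R) (n : nat) (x : 'I_n -> R)
    (x_sorted : forall i j : 'I_n, (i <= j)%N -> x i <= x j)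
    (p : R -> R) (p_range : forall t : R, 0 <= p t <= 1)
    (Y : 'I_n -> {RV P >-> bool})
    (Y_indep : mutual_independence Y)
    (Y_dist : forall i : 'I_n, P (Y i @^-1` [set true]) = (p (x i))%:E)
    (alpha : R) (alpha_range : 0 < alpha < 1)
    (p_isotonic : forall s t : R, s <= t -> p s <= p t) :
  ((1 - alpha)%:E <=
    P [set w | forall t : R,
         (L_raw x alpha (fun i => Y i w) t <= p t
           <= U_raw x alpha (fun i => Y i w) t)%R])%E.
Proof.
have [a0 a1] := andP alpha_range.
set delta := raw_level x alpha; set M := (num_distinct x ^ 2 + num_distinct x)%N.
have delta01 : 0 <= delta <= 1.
  rewrite divr_ge0 ?ler0n ?(ltW a0)//=; rewrite /delta /raw_level -/M.
  (* [M = 0] means that there are no design points; division by 0 then makes [delta] equal to 0. *)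
  have [->|M0] := posnP M; first by rewrite invr0 mulr0.
  by rewrite ler_pdivrMr ?ltr0n// mul1r (le_trans (ltW a1))// ler1n.
have Mdelta : M%:R * delta <= alpha.
  rewrite /delta /raw_level -/M; have [->|M0] := posnP M.
    by rewrite mul0r ltW.
  by rewrite mulrCA divff ?mulr1// pnatr_eq0 -lt0n.
pose J := [set jk | `[< index_pairs x jk >]]%SET.
pose badU (jk : 'I_n * 'I_n) := [set w | cp_upper delta
  (\sum_(i <- block jk.1 jk.2) Y i w) (size (block jk.1 jk.2)) < p (x jk.1)].
pose badL (jk : 'I_n * 'I_n) := [set w | p (x jk.2) < cp_lower delta
  (\sum_(i <- block jk.1 jk.2) Y i w) (size (block jk.1 jk.2))].
have mU jk : measurable (badU jk).
  exact: (measurable_RV_finite _ _ _ _ _ Y (fun y => cp_upper delta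
    (\sum_(i <- block jk.1 jk.2) y i) (size (block jk.1 jk.2)) < p (x jk.1))).
have mL jk : measurable (badL jk).
  exact: (measurable_RV_finite _ _ _ _ _ Y (fun y => p (x jk.2) <
    cp_lower delta (\sum_(i <- block jk.1 jk.2) y i)
      (size (block jk.1 jk.2)))).
set good := [set w | _].
have mgood : measurable good.
  exact: (measurable_RV_finite _ _ _ _ _ Y (fun y => forall t : R,
    L_raw x alpha y t <= p t <= U_raw x alpha y t)).
have PU jk : (P (badU jk) <= delta%:E)%E.
  apply: (miscoverage_upper _ _ _ _ _ _ Y_indep (fun i => p (x i)))=> //.
  - exact: block_uniq.
  - move=> i; rewrite mem_filter => /andP[/andP[ji _] _].
    by apply/p_isotonic/x_sorted.
have PL jk : (P (badL jk) <= delta%:E)%E.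
  apply: (miscoverage_lower _ _ _ _ _ _ Y_indep (fun i => p (x i)))=> //.
  - exact: block_uniq.
  - move=> i; rewrite mem_filter => /andP[/andP[_ ik] _].
    by apply/p_isotonic/x_sorted.
pose bad := \big[setU/set0]_(jk in J) (badU jk `|` badL jk).
have mbad : measurable bad.
  by apply: bigsetU_measurable => jk _; exact: measurableU.
have Pbad : (P bad <= alpha%:E)%E.
  apply: (le_trans (le_measure_bigsetU _ _ _ _ _ _ _ _ _)) => [jk|].
    exact: measurableU.
  apply: (@le_trans _ _ (\sum_(jk in J) (delta + delta)%:E)%E).
    apply: lee_sum => jk _; rewrite EFinD.
    by apply: le_trans (leeD (PU jk) (PL jk)); exact: measureU2.
  (* Each index pair contributes [2 * delta], and twice the number of index pairs is at most [M]. *)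
  rewrite sumEFin lee_fin big_const iter_addr_0 (le_trans _ Mdelta)//.
  rewrite -mulr2n -mulrnA -[leLHS]mulr_natl ler_wpM2r ?(andP delta01).1//.
  by rewrite ler_nat mulnC; exact: card_index_pairs.
have good_bad : ~` bad `<=` good.
  move=> w nbad t.
  have cov jk : index_pairs x jk ->
      cp_lower delta (block_sum (fun i => Y i w) jk.1 jk.2)
        (block_size jk.1 jk.2) <= p (x jk.2) /\
      p (x jk.1) <= cp_upper delta (block_sum (fun i => Y i w) jk.1 jk.2)
        (block_size jk.1 jk.2).
    move=> Jjk; have [jk12 _ _] := Jjk.
    have nb : ~ (badU jk `|` badL jk) w.
      move=> bw; apply: nbad; rewrite /bad (bigD1 jk) ?inE//=; left; exact: bw.
    rewrite block_sumE block_sizeE//; split; rewrite leNgt; apply/negP => b.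
      by apply: nb; right.
    by apply: nb; left.
  have [pt0 pt1] := andP (p_range t); apply/andP; split.
    (* Over an empty set of index pairs the defaults 0 and 1 bound [p t] by [p_range]; otherwise
       isotonicity carries each bound from the block's end point to [t]. *)
    rewrite /L_raw /sup_or0; case: ifPn => // /set0P S0.
    apply: ge_sup => // _ [jk [Jjk jkt] <-].
    exact: le_trans (cov jk Jjk).1 (p_isotonic _ _ jkt).
  rewrite /U_raw /inf_or1; case: ifPn => // /set0P S0.
  apply: lb_le_inf => // _ [jk [Jjk jkt] <-].
  exact: le_trans (p_isotonic _ _ jkt) (cov jk Jjk).2.
apply: (@le_trans _ _ (P (~` bad))).
  by rewrite probability_setC// EFinB leeB.
by apply: le_measure => //; rewrite inE//; exact: measurableC.
Qed.
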